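(* Let $I=(G=(V,E),\mathcal{C},\omega,\ell,b)$ be an instance of \textsc{Stars NWS} and $E^*\subseteq E$. For each community $C\in\mathcal{C}$ with $|\mathfrak{C}(C)|\ge 2$ and each minimum solution $G'$ that is fitting for $E^*$, there is a vertex $v\in\bigcap_{\widetilde C\in\mathfrak{C}(C)}\widetilde C$ such that $\mathrm{univ}_{G'}(\widetilde C)=\{v\}$ for every $\widetilde C\in\mathfrak{C}(C)$.
   Context: A solution of \textsc{Stars NWS} is a spanning subgraph $G'=(V,E')$, $E'\subseteq E$, $|E'|\le\ell$, $\omega(E')\le b$, such that for each $C\in\mathcal{C}$ the set $\mathrm{univ}_{G'}(C)$ of vertices $u\in C$ adjacent in $G'$ to all of $C\setminus\{u\}$ is nonempty; a minimum solution has the minimum number of edges. A vertex $v$ is locally universal for $A\subseteq V$ if $\{v,w\}\in E^*$ for all $w\in A\setminus\{v\}$. Two distinct communities $C_1,C_2$ induce a local cycle in $G'$ if there are $c_i\in\mathrm{univ}_{G'}(C_i)$ such that the graph on $C_1\cup C_2$ with edges $\{\{c_i,w\}: w\in C_i\setminus\{c_i\}, i\in\{1,2\}\}$ contains a cycle; these cycles are local cycles of $G'$. A minimum solution $G'$ is fitting for $E^*$ if $E^*\subseteq E(G')$ and every local cycle of $G'$ uses only edges of $E^*$. Let $G_{\mathfrak{C}}$ be the auxiliary graph with vertex set $\mathcal{C}$ in which distinct $C,D$ are adjacent iff $|C\cap D|\ge 3$ and no vertex of $C\cup D$ is locally universal for $C\cap D$; $\mathfrak{C}(C)$ denotes the set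 of communities in the connected component of $G_{\mathfrak{C}}$ containing $C$. *)

(* Defs.v *)
From mathcomp Require Import all_boot all_order all_algebra.

Set Implicit Arguments.
Unset Strict Implicit.
Unset Printing Implicit Defensive.

Import Order.TTheory GRing.Theory Num.Theory.

(* An undirected edge {v, w} is the two-element set [set v; w]. A spanning
   subgraph (V, F) is represented by its edge set F : {set {set V}}. *)

(* Only the values of [weight] on [edges] matter. *)
Record starsNWS (V : finType) (R : realDomainType) := StarsNWS {
  edges : {set {set V}};
  edges_simple : forall e, e \in edges -> #|e| = 2;
  communities : {set {set V}};
  weight : {set V} -> R;
  max_edges : nat;
  budget : R
}.

Section Graphs.
Variable V : finType.
Implicit Types (F Estar : {set {set V}}) (A C D : {set V}) (p : seq V).

Definition univ F C : {set V} :=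
  [set u in C | [forall w in C :\ u, [set u; w] \in F]].

Definition locally_universal Estar A (v : V) : bool :=
  [forall w in A :\ v, [set v; w] \in Estar].

Definition star (c : V) C : {set {set V}} := [set [set c; w] | w in C :\ c].

Definition is_cycle F p : bool :=
  [&& 2 < size p, uniq p & cycle (fun x y => [set x; y] \in F) p].

Definition cycle_edges p : {set {set V}} := [set [set x; next p x] | x in p].

End Graphs.

Section Problem.
Variables (V : finType) (R : realDomainType) (I : starsNWS V R).
Implicit Types (F Estar : {set {set V}}) (C D : {set V}) (p : seq V).

Definition solution F : Prop :=
  [/\ F \subset edges I,
      #|F| <= max_edges I,
      (\sum_(e in F) weight I e <= budget I)%R &
      forall C, C \in communities I -> univ F C != set0].

Definition minimum_solution F : Prop :=
  solution F /\ forall F', solution F' -> #|F| <= #|F'|.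

Definition local_cycle F p : Prop :=
  exists C1 C2 c1 c2,
    [/\ C1 \in communities I, C2 \in communities I & C1 != C2] /\
    [/\ c1 \in univ F C1, c2 \in univ F C2 &
        is_cycle (star c1 C1 :|: star c2 C2) p].

Definition fitting Estar F : Prop :=
  Estar \subset F /\
  forall p, local_cycle F p -> cycle_edges p \subset Estar.

Definition aux_adj Estar : rel {set V} := fun C D =>
  [&& C \in communities I, D \in communities I, C != D, 3 <= #|C :&: D| &
      [forall v in C :|: D, ~~ locally_universal Estar (C :&: D) v]].

Definition aux_component Estar C : {set {set V}} :=
  [set D in communities I | connect (aux_adj Estar) C D].

End Problem.

(* Main.v *)
(** Let C and D be adjacent in the auxiliary graph, with c universal for C and
    d universal for D. If c <> d, every w in (C :&: D) :\ c lies with c on a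
    cycle of length 3 or 4 in the union of the stars of c and d. This is a local
    cycle, so {c, w} is in Estar; hence c is locally universal for C :&: D, a
    contradiction. Adjacent communities therefore have the same, unique,
    universal vertex, and this propagates along paths. *)
Require Import Defs.
From mathcomp Require Import all_boot all_order all_algebra.

Set Implicit Arguments.
Unset Strict Implicit.
Unset Printing Implicit Defensive.

Section FiniteTypes.
Variable T : finType.

Lemma card_connect_gt1 (e : rel T) x :
  1 < #|connect e x| -> exists y, e x y.
Proof.
move=> card_gt1; have /subsetPn[y] : ~~ (connect e x \subset pred1 x).
  by apply: contraL card_gt1 => /subset_leq_card; rewrite card1 -leqNgt.
case/connectP=> [[|z p] /= path_p ->]; first by rewrite inE eqxx.
by move=> _; exists z; case/andP: path_p.
Qed.

Lemma cross_eq_set1 (A B : {set T}) :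
    A != set0 -> B != set0 -> {in A & B, forall x y, x = y} ->
  exists x, A = [set x] /\ B = [set x].
Proof.
move=> /set0Pn[x xA] /set0Pn[y yB] eqAB; exists x.
split; apply/setP => z; rewrite inE; apply/idP/eqP => [zS|->] //.
- by rewrite (eqAB z y) // (eqAB x y).
- by rewrite (eqAB x z).
- by rewrite (eqAB x y).
Qed.

End FiniteTypes.

Section Stars.
Variable V : finType.
Implicit Types (F : {set {set V}}) (C D : {set V}).

Lemma univ_sub F C : univ F C \subset C.
Proof. by apply/subsetP => u /setIdP[]. Qed.

Lemma mem_starl c w C : ([set c; w] \in star c C) = (w \in C :\ c).
Proof.
apply/imsetP/idP => [[u uC eq_cw]|wC]; last by exists w.
have /set2P[eq_uc|<-//] : u \in [set c; w] by rewrite eq_cw set22.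
by rewrite eq_uc setD11 in uC.
Qed.

Lemma mem_starr c w C : ([set w; c] \in star c C) = (w \in C :\ c).
Proof. by rewrite setUC mem_starl. Qed.

Lemma cycle_edges_head (x y : V) p : [set x; y] \in cycle_edges [:: x, y & p].
Proof. by apply/imsetP; exists x; rewrite ?mem_head //= eqxx. Qed.

(* The cycle is c, w, d, w', except that d is skipped when it is w or w'. *)
Lemma star_cycle c d w w' C D :
    c != d -> w \in (C :&: D) :\ c -> w' \in (C :&: D) :\ c -> w != w' ->
  exists p, is_cycle (star c C :|: star d D) [:: c, w & p].
Proof.
move=> cd /setD1P[wc /setIP[wC wD]] /setD1P[w'c /setIP[w'C w'D]] ww'.
have [cw cw'] : c != w /\ c != w' by split; rewrite eq_sym.
have cw_edge : [set c; w] \in star c C by rewrite mem_starl in_setD1 wc.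
have w'c_edge : [set w'; c] \in star c C by rewrite mem_starr in_setD1 w'c.
have [/set2P d_leaf|] := boolP (d \in [set w; w']).
  have ww'_edge : [set w; w'] \in star d D.
    case: d_leaf => ->; first by rewrite mem_starl in_setD1 eq_sym ww'.
    by rewrite mem_starr in_setD1 ww'.
  exists [:: w']; rewrite /is_cycle /= !in_setU cw_edge ww'_edge w'c_edge.
  by rewrite !inE negb_or cw cw' ww' !orbT.
rewrite !inE negb_or => /andP[dw dw']; have wd : w != d by rewrite eq_sym.
have wd_edge : [set w; d] \in star d D by rewrite mem_starr in_setD1 wd.
have dw'_edge : [set d; w'] \in star d D.
  by rewrite mem_starl in_setD1 eq_sym dw'.
exists [:: d; w'].
rewrite /is_cycle /= !in_setU cw_edge wd_edge dw'_edge w'c_edge.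
by rewrite !inE !negb_or cw cd cw' wd ww' dw' !orbT.
Qed.

End Stars.

Section AuxiliaryGraph.
Variables (V : finType) (R : realDomainType) (I : starsNWS V R).
Variables (Estar F : {set {set V}}).
Hypothesis fitF : fitting I Estar F.
Implicit Types (C D : {set V}).

Lemma fitting_locally_universal C D c d :
    C \in communities I -> D \in communities I -> C != D ->
    c \in univ F C -> d \in univ F D -> c != d -> 2 < #|C :&: D| ->
  locally_universal Estar (C :&: D) c.
Proof.
move=> CI DI CD cU dU cd card_gt2; apply/forall_inP => w wCD.
have /subsetPn[w' w'CD] : ~~ (C :&: D \subset [set c; w]).
  apply: contraL card_gt2 => /subset_leq_card; rewrite -leqNgt.
  by move=> /leq_trans; apply; rewrite cards2; case: (_ != _).
rewrite !inE negb_or => /andP[w'c w'w].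
have [p p_cycle] : exists p, is_cycle (star c C :|: star d D) [:: c, w & p].
  by apply: (star_cycle (w' := w')); rewrite // 1?eq_sym // in_setD1 w'c.
apply: (subsetP (proj2 fitF [:: c, w & p] _)); last exact: cycle_edges_head.
by exists C, D, c, d.
Qed.

Lemma aux_adj_univ_eq C D :
  aux_adj I Estar C D -> {in univ F C & univ F D, forall c d, c = d}.
Proof.
move=> /and5P[CI DI CD card_gt2 /forall_inP noLU] c d cU dU.
apply/eqP/negPn/negP => cd.
have /noLU/negP[] : c \in C :|: D by rewrite inE (subsetP (univ_sub F C)).
exact: fitting_locally_universal cd card_gt2.
Qed.

Hypothesis solF : solution I F.

Lemma aux_adj_univ1 C D :
  aux_adj I Estar C D -> exists v, univ F C = [set v] /\ univ F D = [set v].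
Proof.
move=> adjCD; have [_ _ _ univ_neq0] := solF.
have [CI DI _ _ _] := and5P adjCD.
exact: cross_eq_set1 (univ_neq0 C CI) (univ_neq0 D DI) (aux_adj_univ_eq adjCD).
Qed.

Lemma closed_aux_adj_univ (A : {set V}) :
  closed (aux_adj I Estar) [pred D | univ F D == A].
Proof.
by move=> C D /aux_adj_univ1[v [univC univD]]; rewrite !inE univC univD.
Qed.

End AuxiliaryGraph.

Theorem corollary13 (V : finType) (R : realDomainType) (I : starsNWS V R)
    (Estar : {set {set V}}) (hEstar : Estar \subset edges I)
    (C : {set V}) (hC : C \in communities I)
    (hcomp : 2 <= #|aux_component I Estar C|)
    (F : {set {set V}}) (hmin : minimum_solution I F)
    (hfit : fitting I Estar F) :
  exists v : V,
    v \in \bigcap_(D in aux_component I Estar C) D /\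
    forall D : {set V}, D \in aux_component I Estar C -> univ F D = [set v].
Proof.
have [solF _] := hmin.
have [B adjCB] : exists B, aux_adj I Estar C B.
  apply/card_connect_gt1/(leq_trans hcomp)/subset_leq_card.
  by apply/subsetP => D /setIdP[].
have [v [univC _]] := aux_adj_univ1 hfit solF adjCB.
have univ_comp D : D \in aux_component I Estar C -> univ F D = [set v].
  case/setIdP=> _ /(closed_connect (closed_aux_adj_univ hfit solF [set v])).
  by rewrite !inE univC eqxx => /esym/eqP.
exists v; split=> //; apply/bigcapP => D /univ_comp univD.
by apply: (subsetP (univ_sub F D)); rewrite univD set11.
Qed.
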